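(* Let $A$ be any real $m \times n$ matrix whose columns all have Euclidean ($\ell_2$) norm at most $1$. Then $\mathrm{vecdisc}(A) \leq 1$; that is, there exist unit vectors $u_1, \ldots, u_n \in S^{n-1} \subset \mathbb{R}^n$ such that for every $i \in \{1, \ldots, m\}$, $$\Big\| \sum_{j=1}^n A_{ij} u_j \Big\|_2 \leq 1.$$
   Context: For a real $m\times n$ matrix $A$, the vector discrepancy is defined as $$\mathrm{vecdisc}(A) = \min_{u_1, \ldots, u_n \in S^{n-1}} \max_{1 \le i \le m} \Big\| \sum_{j=1}^n A_{ij} u_j \Big\|_2,$$ where $S^{n-1}$ is the unit sphere in $\mathbb{R}^n$ (the minimum is attained). *)

(* Defs.v *)
From HB Require Import structures.
From mathcomp Require Import all_boot all_order all_algebra.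
From mathcomp Require Import all_classical all_reals.

Set Implicit Arguments.
Unset Strict Implicit.
Unset Printing Implicit Defensive.

Import Order.TTheory GRing.Theory Num.Theory.
Local Open Scope classical_set_scope.
Local Open Scope ring_scope.

(* The norm that MathComp-Analysis puts on matrices is the sup norm, hence
   an explicit Euclidean norm. *)
Definition l2norm (R : realType) (k : nat) (v : 'cV[R]_k) : R :=
  Num.sqrt (\sum_(i < k) v i 0 ^+ 2).

Definition unit_sphere (R : realType) (k : nat) : set 'cV[R]_k :=
  [set v | l2norm v = 1].
Arguments unit_sphere : clear implicits.

(* The norms are nonnegative, so starting the maximum from 0 only matters
   when m = 0. *)
Definition vecdisc_val (R : realType) (m n : nat) (A : 'M[R]_(m, n))
    (u : 'I_n -> 'cV[R]_n) : R :=
  \big[Num.max/0]_(i < m) l2norm (\sum_(j < n) A i j *: u j).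

(* The minimum is taken as an infimum: the set is nonempty, bounded below
   by 0, and its infimum is attained. *)
Definition vecdisc (R : realType) (m n : nat) (A : 'M[R]_(m, n)) : R :=
  inf [set vecdisc_val A u | u in [set u | forall j, unit_sphere R n (u j)]].

(* Main.v *)
(** The unit vectors are the rows of an [n x n] matrix [L] obtained by running
    the Gram-Schmidt walk of Bansal, Dadush, Garg and Lovett on covariances
    instead of on random signs.  A set [S] of coordinates [j] with remaining
    budgets [d j] is alive, one of them being the pivot [p].  Let [u] be the
    vector supported on [S] with [u p = 1] for which [w = A u] is the component
    of the column [a_p] orthogonal to the other alive columns.  Add
    [s u u^T] to the covariance [Y = L L^T], with [s] as large as the budgets
    [d j - s u_j^2 >= 0] allow; this freezes a coordinate, and a new pivot is
    taken only when the pivot itself is frozen.  During the phase of a pivot the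
    vectors [w] have norm at most 1, are orthogonal to the columns still alive
    at the end of the phase, and the steps [s] add up to the budget of the pivot,
    which is at most 1; hence the phases contribute below mutually orthogonal
    projections and [A Y A^T <= 1].  There is one step per frozen coordinate, so
    [n] columns suffice for [L]. *)
Require Import Defs.
From HB Require Import structures.
From mathcomp Require Import all_boot all_order all_algebra.
From mathcomp Require Import all_classical all_reals.
From mathcomp Require Import ring lra.

Set Implicit Arguments.
Unset Strict Implicit.
Unset Printing Implicit Defensive.

Import Order.TTheory GRing.Theory Num.Theory.
Local Open Scope classical_set_scope.
Local Open Scope ring_scope.

(** * Euclidean inner product and orthogonal projections *)

Definition dot (R : realType) (k : nat) (x y : 'cV[R]_k) : R := (x^T *m y) 0 0.

Section Dot.
Variables (R : realType) (k : nat).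
Implicit Types (x y z w : 'cV[R]_k) (P : 'M[R]_k).

Lemma dotE x y : dot x y = \sum_i x i 0 * y i 0.
Proof. by rewrite /dot mxE; apply: eq_bigr => i _; rewrite mxE. Qed.

Lemma dotC x y : dot x y = dot y x.
Proof. by rewrite !dotE; apply: eq_bigr => i _; rewrite mulrC. Qed.

Lemma dotBr x y z : dot x (y - z) = dot x y - dot x z.
Proof. by rewrite /dot mulmxBr !mxE. Qed.

Lemma dotBl x y z : dot (x - y) z = dot x z - dot y z.
Proof. by rewrite dotC dotBr !(dotC z). Qed.

Lemma dotZr (a : R) x y : dot x (a *: y) = a * dot x y.
Proof. by rewrite /dot -scalemxAr mxE. Qed.

Lemma dotZl (a : R) x y : dot (a *: x) y = a * dot x y.
Proof. by rewrite dotC dotZr dotC. Qed.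

Lemma dot0l x : dot 0 x = 0.
Proof. by rewrite -(scale0r 0) dotZl mul0r. Qed.

Lemma dot_ge0 x : 0 <= dot x x.
Proof. by rewrite dotE sumr_ge0 // => i _; rewrite -expr2 sqr_ge0. Qed.

Lemma dot_eq0 x : dot x x = 0 -> x = 0.
Proof.
rewrite dotE => /eqP; rewrite psumr_eq0 => [/allP x0|i _]; last first.
  by rewrite -expr2 sqr_ge0.
apply/colP => i; rewrite mxE; apply/eqP.
by have := x0 i (mem_index_enum i); rewrite mulf_eq0 orbb.
Qed.

Lemma dot_mulmxl (l : nat) (M : 'M[R]_(k, l)) (x : 'cV[R]_l) y :
  dot (M *m x) y = dot x (M^T *m y).
Proof. by rewrite /dot trmx_mul mulmxA. Qed.

Lemma dot_proj P x y : P^T = P -> P *m P = P -> dot (P *m x) (P *m y) = dot x (P *m y).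
Proof. by move=> Ps Pi; rewrite dot_mulmxl Ps mulmxA Pi. Qed.

Lemma dot_proj_compl P x : P^T = P -> P *m P = P ->
  dot (x - P *m x) (x - P *m x) = dot x x - dot (P *m x) (P *m x).
Proof.
move=> Ps Pi; rewrite dotBl !dotBr dot_proj // (dotC (P *m x) x); lra.
Qed.

Lemma dot_proj_le P x : P^T = P -> P *m P = P -> dot (P *m x) (P *m x) <= dot x x.
Proof. by move=> Ps Pi; rewrite -subr_ge0 -dot_proj_compl // dot_ge0. Qed.

(** Since [P] kills [w], only the component [y - P *m y] pairs with [w]; Cauchy-Schwarz then applies
    to it. *)
Lemma bessel_proj P w y : P^T = P -> P *m P = P -> P *m w = 0 -> dot w w <= 1 ->
  dot w y ^+ 2 <= dot y y - dot (P *m y) (P *m y).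
Proof.
move=> Ps Pi Pw w1; rewrite -dot_proj_compl //; set z := y - P *m y.
have -> : dot w y = dot w z.
  by rewrite dotBr -Ps -dot_mulmxl Pw dot0l subr0.
move: z => z; have := dot_ge0 (z - dot w z *: w).
rewrite dotBl !dotBr !dotZl !dotZr (dotC z w).
have : 0 <= dot w z ^+ 2 * (1 - dot w w) by rewrite mulr_ge0 ?sqr_ge0 ?subr_ge0.
lra.
Qed.

End Dot.

(* [K] carries the coordinates of the projections on the columns in [T]. *)
Definition is_col_proj (R : realType) (m n : nat) (A : 'M[R]_(m, n))
    (T : {set 'I_n}) (K : 'M[R]_(n, m)) : Prop :=
  [/\ (A *m K)^T = A *m K, A *m K *m (A *m K) = A *m K,
      forall j, j \notin T -> forall i, K j i = 0
    & forall j, j \in T -> A *m K *m col j A = col j A].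

(** * Projections onto spans of columns *)

Section GramSchmidtWalk.
Variables (R : realType) (m n : nat) (A : 'M[R]_(m, n)).
Implicit Types (S T : {set 'I_n}) (K : 'M[R]_(n, m)) (L : 'M[R]_n) (d : 'I_n -> R).

(** Gram-Schmidt by induction on [#|T|]: either the residual [w] of a column against the others
    vanishes and [K] is kept, or the rank-one projection on [w] is added. *)
Lemma col_proj_ex T : exists K, is_col_proj A T K.
Proof.
move: {2}#|T| (erefl #|T|) => k; elim: k T => [|k IH] T cT.
  have T0 : T = finset.set0 by apply/eqP; rewrite -cards_eq0 cT.
  exists 0; split; rewrite ?mulmx0 ?trmx0 ?mul0mx //.
    by move=> j _ i; rewrite mxE.
  by move=> j; rewrite T0 inE.
have [p pT] : exists p, p \in T by apply/card_gt0P; rewrite cT.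
have [K [Ps Pi K0 Pid]] : exists K, is_col_proj A (T :\ p)%SET K.
  by apply: IH; move: cT; rewrite (cardsD1 p) pT => -[].
set P := A *m K in Ps Pi Pid.
set w := col p A - P *m col p A.
have Pw : P *m w = 0 by rewrite mulmxBr mulmxA Pi subrr.
have [w0|wN0] := eqVneq (dot w w) 0.
  have {}w0 := dot_eq0 w0.
  exists K; split => // [j jT i|j jT].
    by apply: K0; rewrite !inE (negPf jT) andbF.
  have [->|jp] := eqVneq j p; last by apply: Pid; rewrite !inE jp.
  by apply/esym/eqP; rewrite -subr_eq0; apply/eqP.
(* [u] holds the coefficients of [w] in the columns, so [c *: (u *m w^T)] is the coefficient matrix
   of the projection on [w]. *)
pose u : 'cV[R]_n := delta_mx p 0 - K *m col p A.
have Au : A *m u = w by rewrite mulmxBr mulmxA -colE.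
pose c := (dot w w)^-1.
exists (K + c *: (u *m w^T)).
have AK : A *m (K + c *: (u *m w^T)) = P + c *: (w *m w^T).
  by rewrite mulmxDr -scalemxAr mulmxA Au.
have wP : w^T *m P = 0 by rewrite -Ps -trmx_mul Pw trmx0.
have wwM : w^T *m w = (dot w w)%:M by rewrite [LHS]mx11_scalar.
have wp : w^T *m col p A = (dot w w)%:M.
  by rewrite -wwM /w mulmxBr mulmxA wP mul0mx subr0.
split; rewrite ?AK.
- by rewrite linearD linearZ /= Ps trmx_mul trmxK.
- rewrite mulmxDl !mulmxDr Pi -!scalemxAr -!scalemxAl.
  rewrite [P *m (w *m _)]mulmxA Pw mul0mx -(mulmxA w) wP mulmx0 !scaler0 addr0 add0r.
  rewrite -(mulmxA w) (mulmxA w^T) wwM mul_scalar_mx -scalemxAr scalerA.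
  by rewrite scalerA -mulrA mulVf ?mulr1.
- move=> j jT i.
  have jp : j != p by apply: contraNneq jT => ->.
  have Kj0 i' : K j i' = 0 by apply: K0; rewrite !inE (negPf jT) andbF.
  rewrite !mxE Kj0 big_ord1 !mxE (negPf jp) /= big1 => [|i' _].
    by rewrite subr0 mul0r mulr0 addr0.
  by rewrite Kj0 mul0r.
- move=> j jT; rewrite mulmxDl -scalemxAl -mulmxA.
  have [->|jp] := eqVneq j p.
    rewrite wp mul_mx_scalar scalerA /c mulVf // scale1r /w.
    by rewrite addrCA subrr addr0.
  have Pj : P *m col j A = col j A by apply: Pid; rewrite !inE jp.
  have wj : w^T *m col j A = 0 by rewrite -Pj mulmxA wP mul0mx.
  by rewrite Pj wj mulmx0 scaler0 addr0.
Qed.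

(** The range of the smaller projection lies in that of the larger one; transposing this gives that
    their product in the other order is again the smaller one. *)
Lemma col_proj_ortho T T' K K' : is_col_proj A T K -> is_col_proj A T' K' ->
  T' \subset T -> forall x : 'cV[R]_m, A *m K' *m (x - A *m K *m x) = 0.
Proof.
move=> [Ps Pi _ Pid] [P's _ K'0 _] sT x.
have PP' : A *m K *m (A *m K') = A *m K'.
  rewrite mulmxA; apply/matrixP => i l; rewrite mxE [RHS]mxE; apply: eq_bigr => j _.
  have [jT'|jT'] := boolP (j \in T'); last by rewrite K'0 // !mulr0.
  congr (_ * _).
  have := Pid j (fintype.subsetP sT j jT') => /colP/(_ i).
  by rewrite colE mulmxA -!colE [LHS]mxE [RHS]mxE.
have P'P : A *m K' *m (A *m K) = A *m K'.
  by rewrite -[LHS]trmxK trmx_mul Ps P's PP' P's.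
by rewrite mulmxBr [X in _ - X]mulmxA P'P subrr.
Qed.

(** * Covariances and steps of the walk *)

Definition qform L (y : 'cV[R]_m) : R := dot (L^T *m (A^T *m y)) (L^T *m (A^T *m y)).

(** The columns of [L] are indexed by alive coordinates too: each coordinate, when frozen, supplies
    the column that stores its step. *)
Definition gsw_spec S d L : Prop :=
  (forall j c, (j \notin S) || (c \notin S) -> L j c = 0) /\
  (forall j, j \in S -> \sum_c L j c ^+ 2 = d j).

(** Column [j0] of [L] is zero, so writing [Num.sqrt s *: u] there adds exactly [s u u^T] to
    [L L^T]. Row [j0] is zero as well, so the step must use up the whole budget of [j0]. *)
Lemma gsw_spec_add S d L j0 (s : R) (u : 'cV[R]_n) :
    j0 \in S -> 0 <= s -> (forall j, j \notin S -> u j 0 = 0) ->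
    s * u j0 0 ^+ 2 = d j0 ->
    gsw_spec (S :\ j0)%SET (fun j => d j - s * u j 0 ^+ 2) L ->
  exists2 L', gsw_spec S d L' &
    forall y, qform L' y = qform L y + s * dot (A *m u) y ^+ 2.
Proof.
move=> j0S s0 u0 sj0 [L0 Ld].
exists (L + Num.sqrt s *: (u *m delta_mx 0 j0)).
  have L'E j c : (L + Num.sqrt s *: (u *m delta_mx 0 j0)) j c =
      if c == j0 then Num.sqrt s * u j 0 else L j c.
    rewrite !mxE big_ord1 !mxE /=; case: eqVneq => [->|_].
      by rewrite L0 ?mulr1 ?add0r // !inE eqxx /= orbT.
    by rewrite !mulr0 addr0.
  split=> [j c jc|j jS].
    rewrite L'E; case: eqVneq => [cj|cj].
      by rewrite u0 ?mulr0 //; move: jc; rewrite cj j0S orbF.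
    by apply: L0; rewrite !inE !negb_and; case/orP: jc => ->; rewrite !orbT.
  rewrite (bigD1 j0) //= L'E eqxx exprMn sqr_sqrtr //.
  have -> : \sum_(i < n | i != j0)
      (L + Num.sqrt s *: (u *m delta_mx 0 j0)) j i ^+ 2 = \sum_i L j i ^+ 2.
    rewrite [RHS](bigD1 j0) //= L0 ?expr0n /= ?add0r; last first.
      by rewrite !inE eqxx orbT.
    by apply: eq_bigr => i /negPf ij; rewrite L'E ij.
  have [->|jj0] := eqVneq j j0.
    rewrite sj0 big1 ?addr0 // => i _.
    by rewrite L0 ?expr0n // !inE eqxx.
  by rewrite Ld ?inE ?jj0 // addrCA subrr addr0.
move=> y; rewrite /qform linearD linearZ /= mulmxDl -scalemxAl trmx_mul.
set z := A^T *m y.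
have -> : (delta_mx 0 j0)^T *m u^T *m z = dot u z *: delta_mx j0 (0 : 'I_1).
  by rewrite -mulmxA [u^T *m z]mx11_scalar mul_mx_scalar trmx_delta.
rewrite (dot_mulmxl A) -/z.
have Lj0 : dot (L^T *m z) (delta_mx j0 0) = 0.
  rewrite dotE big1 // => i _; rewrite !mxE andbT.
  case: eqVneq => [->|_]; last by rewrite mulr0.
  rewrite big1 ?mul0r // => j _; rewrite mxE L0 ?mul0r //.
  by rewrite !inE eqxx orbT.
have d1 : dot (delta_mx j0 0 : 'cV[R]_n) (delta_mx j0 0) = 1.
  rewrite dotE (bigD1 j0) //= !mxE !eqxx mulr1 big1 ?addr0 // => i /negPf ij.
  by rewrite !mxE ij mul0r.
rewrite -[_ *: (_ *: _)]opprK dotBl !dotBr -!scaleNr !dotZl !dotZr.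
rewrite (dotC (delta_mx j0 0)) Lj0 d1.
have := sqr_sqrtr s0; set r := Num.sqrt s => <-; ring.
Qed.

(** Only inner products of [y] with the columns in [S] enter, and the projection preserves them. *)
Lemma qform_proj S K d L y : is_col_proj A S K -> gsw_spec S d L ->
  qform L y = qform L (A *m K *m y).
Proof.
move=> [Ps _ _ Pid] [L0 _]; rewrite /qform.
suff -> : L^T *m (A^T *m y) = L^T *m (A^T *m (A *m K *m y)) by [].
apply/colP => c; rewrite !mxE; apply: eq_bigr => j _; rewrite mxE.
have [jS|jS] := boolP (j \in S); last by rewrite L0 ?jS // !mul0r.
congr (_ * _).
have E (x : 'cV[R]_m) : (A^T *m x) j 0 = dot (col j A) x.
  by rewrite dotE mxE; apply: eq_bigr => i _; rewrite !mxE.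
by rewrite !E -Ps -dot_mulmxl Pid.
Qed.

Hypothesis hA : forall j, dot (col j A) (col j A) <= 1.

(* [S] and [d] are the alive coordinates and their budgets, [p] is the pivot,
   and [T] is the set of coordinates still alive when [p] gets frozen. *)
Lemma gsw_pivot S d p : p \in S -> (forall j, j \in S -> 0 <= d j <= 1) ->
  exists L T K, [/\ gsw_spec S d L, T \subset (S :\ p)%SET, is_col_proj A T K &
    forall y, qform L y <= d p * dot y y +
                           (1 - d p) * dot (A *m K *m y) (A *m K *m y)].
Proof.
move: {2}#|S| (leqnn #|S|) => k; elim: k S d p => [|k IH] S d p cS pS d01.
  by move: cS; rewrite leqn0 cards_eq0 => /eqP S0; rewrite S0 inE in pS.
have cSD j : j \in S -> (#|(S :\ j)%SET| <= k)%N.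
  by move=> jS; move: cS; rewrite (cardsD1 j) jS.
have [K KP] := col_proj_ex (S :\ p)%SET.
have [Ps Pi K0 Pid] := KP.
pose u : 'cV[R]_n := delta_mx p 0 - K *m col p A.
have up : u p 0 = 1.
  rewrite !mxE !eqxx /= big1 ?subr0 // => i _.
  by rewrite K0 ?mul0r // !inE eqxx.
have u0 j : j \notin S -> u j 0 = 0.
  move=> jS; have jp : j != p by apply: contraNneq jS => ->.
  rewrite !mxE (negPf jp) /= big1 ?subr0 // => i _.
  by rewrite K0 ?mul0r // !inE (negPf jS) andbF.
have Au : A *m u = col p A - A *m K *m col p A.
  by rewrite mulmxBr mulmxA -colE.
have w1 : dot (A *m u) (A *m u) <= 1.
  rewrite Au dot_proj_compl // (le_trans _ (hA p)) // gerBl dot_ge0 //.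
pose ok := [pred j | (j \in S) && (u j 0 != 0)].
have okp : ok p by rewrite /= pS up oner_neq0.
(* The smallest ratio is the longest step that keeps all budgets nonnegative; it exhausts the budget
   of [j0]. *)
case: (arg_minP (fun j => d j / u j 0 ^+ 2) okp) => j0 /andP[j0S uj0] j0min.
set s := d j0 / u j0 0 ^+ 2 in j0min.
have u2 j : u j 0 != 0 -> 0 < u j 0 ^+ 2 by move=> uj; rewrite exprn_even_gt0.
have s0 : 0 <= s.
  by rewrite divr_ge0 ?sqr_ge0 //; case/andP: (d01 j0 j0S).
have sj0 : s * u j0 0 ^+ 2 = d j0 by rewrite divfK // gt_eqF // u2.
have sd j : j \in S -> 0 <= s * u j 0 ^+ 2 <= d j.
  move=> jS; have [uj|uj] := eqVneq (u j 0) 0.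
    by rewrite uj expr0n mulr0 lexx; case/andP: (d01 j jS).
  rewrite mulr_ge0 ?sqr_ge0 //= -ler_pdivlMr ?u2 //.
  by apply: j0min; rewrite /= jS.
pose d' j := d j - s * u j 0 ^+ 2.
have d'01 j : j \in (S :\ j0)%SET -> 0 <= d' j <= 1.
  rewrite !inE => /andP[_ jS].
  have /andP[? ?] := sd j jS; have /andP[? ?] := d01 j jS.
  by rewrite /d'; apply/andP; split; lra.
have Pw : A *m K *m (A *m u) = 0.
  by rewrite Au; apply: (col_proj_ortho KP KP).
have [j0p|j0p] := eqVneq j0 p.
- have [L' L'S L'y] : exists2 L', gsw_spec (S :\ j0)%SET d' L' &
      forall y, qform L' y <= dot y y.
    have [S0|[p' p'S]] := set_0Vmem (S :\ j0)%SET.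
      exists 0; last by move=> y; rewrite /qform trmx0 mul0mx dot0l dot_ge0.
      by rewrite S0; split=> j; rewrite ?inE // => c _; rewrite mxE.
    have [L' [T [K' [L'S _ [P's P'i _ _] Ly]]]] := IH _ _ _ (cSD _ j0S) p'S d'01.
    exists L' => // y; apply: le_trans (Ly y) _.
    have := d'01 _ p'S; have := dot_proj_le y P's P'i; nra.
  have [L LS Ly] := gsw_spec_add j0S s0 u0 sj0 L'S.
  exists L, (S :\ p)%SET, K; split => // y.
  rewrite Ly -j0p -sj0 j0p up expr1n mulr1.
  (* Later phases see only the projection of [y], while this step sees only its complement, with
     weight [s = d p]. *)
  rewrite j0p in L'S; rewrite (qform_proj _ KP L'S).
  have := L'y (A *m K *m y); have := bessel_proj y Ps Pi Pw w1; nra.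
(* The pivot survives with budget [d p - s]. As [T] avoids [p], [w] is orthogonal to the columns in
   [T], so the step moves weight [s] from the projected term to [dot y y]. *)
- have pS' : p \in (S :\ j0)%SET by rewrite !inE eq_sym j0p.
  have [L' [T [K' [L'S TS K'P L'y]]]] := IH _ _ _ (cSD _ j0S) pS' d'01.
  have [P's P'i _ _] := K'P.
  have TS' : T \subset (S :\ p)%SET.
    by apply: fintype.subset_trans TS _; rewrite finset.setSD // finset.subsetDl.
  have [L LS Ly] := gsw_spec_add j0S s0 u0 sj0 L'S.
  exists L, T, K'; split => // y.
  have P'w : A *m K' *m (A *m u) = 0.
    by rewrite Au; apply: (col_proj_ortho KP K'P).
  rewrite Ly; have := L'y y; rewrite /d' up expr1n mulr1.
  have := bessel_proj y P's P'i P'w w1; nra.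
Qed.

Lemma gram_vectors_ex : exists L,
  (forall j, \sum_c L j c ^+ 2 = 1) /\ (forall y, qform L y <= dot y y).
Proof.
have [n0|[p pS]] := set_0Vmem [set: 'I_n]%SET.
  have no (j : 'I_n) : False by have := finset.in_setT j; rewrite n0 inE.
  exists 0; split=> [j|y]; first by case: (no j).
  by rewrite /qform dotE big1 ?dot_ge0 // => j; case: (no j).
(* With all budgets equal to 1 the projected term vanishes. *)
have [|L [T [K [[_ Ld] _ [Ps Pi _ _] Ly]]]] := @gsw_pivot _ (fun=> 1) _ pS.
  by move=> j _; rewrite ler01 lexx.
exists L; split=> [j|y]; first by apply: Ld; rewrite inE.
by have := Ly y; rewrite subrr mul0r addr0 mul1r.
Qed.

End GramSchmidtWalk.

Theorem theorem1 (R : realType) (m n : nat) (A : 'M[R]_(m, n))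
    (hA : forall j : 'I_n, l2norm (col j A) <= 1) :
  vecdisc A <= 1 /\
  exists u : 'I_n -> 'cV[R]_n,
    (forall j : 'I_n, unit_sphere R n (u j)) /\
    (forall i : 'I_m, l2norm (\sum_(j < n) A i j *: u j) <= 1).
Proof.
have l2E k (v : 'cV[R]_k) : l2norm v = Num.sqrt (dot v v).
  by rewrite /l2norm dotE; congr Num.sqrt; apply: eq_bigr => i _; rewrite expr2.
have l2_le1 k (v : 'cV[R]_k) : (l2norm v <= 1) = (dot v v <= 1).
  by rewrite l2E -{1}sqrtr1 ler_sqrt.
have hA' j : dot (col j A) (col j A) <= 1 by rewrite -l2_le1.
have [L [Ld Ly]] := gram_vectors_ex hA'.
pose u j : 'cV[R]_n := (row j L)^T.
have u1 j : unit_sphere R n (u j).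
  rewrite /unit_sphere /= /l2norm -[RHS]sqrtr1 -(Ld j); congr Num.sqrt.
  by apply: eq_bigr => c _; rewrite !mxE.
have uA i : l2norm (\sum_(j < n) A i j *: u j) <= 1.
  rewrite l2_le1.
  (* The squared norm for row [i] is [qform L] at the [i]-th basis vector, which has norm 1. *)
  have -> : \sum_j A i j *: u j = L^T *m (A^T *m delta_mx i 0).
    apply/colP => c; rewrite summxE mxE; apply: eq_bigr => j _.
    by rewrite -colE !mxE mulrC.
  apply: le_trans (Ly _) _.
  rewrite dotE (bigD1 i) //= !mxE !eqxx mulr1 big1 ?addr0 // => j /negPf ji.
  by rewrite !mxE ji mul0r.
split; last by exists u.
apply: (@le_trans _ _ (vecdisc_val A u)); last by apply: bigmax_le.
apply: ge_inf; last by exists u.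
by exists 0 => _ [v _ <-]; apply: bigmax_ge_id.
Qed.
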